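(* Let $n\ge1$ and $s\ge0$, and assume either $n$ is even and $s\le n$, or $n$ is odd and $s\le n-1$. Let $e$ be the greatest even integer with $e\le s$. Then $$\max\{\operatorname{per}(I-A): A\in\omega_n^s\}=2^{e/2}\Big[1+\Big(\frac{s-e}{2}\Big)^2\Big].$$
   Context: An $n\times n$ matrix is doubly substochastic if all its entries are nonnegative and every row sum and column sum is at most $1$. $\sigma(A)$ is the sum of all entries of $A$, and $\omega_n^s$ is the set of $n\times n$ doubly substochastic matrices $A$ with $\sigma(A)=s$. The permanent is $\operatorname{per}(M)=\sum_{\pi\in S_n}\prod_i m_{i\pi(i)}$, and $I$ is the identity matrix. *)

(* Defs.v *)
From HB Require Import structures.
From mathcomp Require Import all_boot all_order all_algebra all_fingroup.
Set Implicit Arguments. Unset Strict Implicit. Unset Printing Implicit Defensive.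
Import Order.TTheory GRing.Theory Num.Theory.
Local Open Scope ring_scope.

Definition per (R : comNzRingType) (n : nat) (M : 'M[R]_n) : R :=
  \sum_(s : 'S_n) \prod_(i < n) M i (s i).

Definition sigma (R : numDomainType) (n : nat) (A : 'M[R]_n) : R :=
  \sum_(i < n) \sum_(j < n) A i j.

Definition doubly_substochastic (R : numDomainType) (n : nat) (A : 'M[R]_n) : Prop :=
  (forall i j, 0 <= A i j) /\
  (forall i, \sum_(j < n) A i j <= 1) /\
  (forall j, \sum_(i < n) A i j <= 1).

Definition omega (R : numDomainType) (n : nat) (s : R) (A : 'M[R]_n) : Prop :=
  doubly_substochastic A /\ sigma A = s.

(* Main.v *)
Require Import Defs.
From HB Require Import structures.
From mathcomp Require Import all_boot all_order all_algebra all_fingroup.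
From mathcomp Require Import ring lra zify.
Import Order.TTheory GRing.Theory Num.Theory.
Local Open Scope ring_scope.

(** The permanent is affine in each row, so only the row sums [r i] matter for
    the upper bound: averaging each row over its entries reduces it to matrices
    with a single nonzero entry [r i], at [f i], in each row [i].  For such a
    matrix, per(I - A) is the sum, over the sets [J] permuted by [f], of the
    products of [- r i] over [J].  These sets form a ring of sets, so splitting
    off a minimal one containing a given point extracts a factor which is at most
    [1] if it is a singleton and at most [1 + r x * r y <= 1 + ((r x + r y) / 2)^2]
    if it contains [x != y].  The resulting product of factors [1 + t^2], with
    0 <= t <= 1 and the sum of the [t]'s at most [s / 2], is largest when all but
    one of the [t]'s are 0 or 1.  Equality holds for a direct sum of 2 x 2
    antidiagonal blocks. *)

(** * Rings of sets and sums over their members *)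

Definition set_ring {T : finType} (V : pred {set T}) : Prop :=
  [/\ V set0, forall J K, V J -> V K -> V (J :|: K)
    & forall J K, V J -> V K -> V (J :\: K)].

Lemma set_ringI {T : finType} {V : pred {set T}} {J K : {set T}} :
  set_ring V -> V J -> V K -> V (J :&: K).
Proof.
case=> _ _ VD VJ VK.
have -> : J :&: K = J :\: (J :\: K) by rewrite setDDr setDv set0U.
by apply: (VD) => //; apply: VD.
Qed.

(** A member [J] either contains [J0] or is disjoint from it: if [x] is not in [J], then [J0 :\: J]
    is a member containing [x], hence all of [J0]. So the members inside [D] pair up as [J] and
    [J0 :|: J]. *)
Lemma sum_set_ring_split {R : comNzRingType} {T : finType} {V : pred {set T}}
    (c : T -> R) {D J0 : {set T}} {x : T} :
  set_ring V -> V J0 -> x \in J0 -> J0 \subset D ->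
  (forall J, V J -> x \in J -> J0 \subset J) ->
  \sum_(J : {set T} | V J && (J \subset D)) \prod_(i in J) c i =
  (1 + \prod_(i in J0) c i) *
  \sum_(J : {set T} | V J && (J \subset D :\: J0)) \prod_(i in J) c i.
Proof.
move=> Vring VJ0 xJ0 J0D J0min; have [_ VU VD] := Vring.
rewrite (bigID (fun J : {set T} => x \in J)) /= addrC mulrDl mul1r; congr (_ + _).
  apply: eq_bigl => J; rewrite -andbA; apply: andb_id2l => VJ.
  rewrite subsetD; apply: andb_id2l => JD; apply/idP/idP => [xJ|].
    rewrite disjoint_sym; apply/setDidPl/eqP.
    rewrite eqEsubset subDset subsetUr /=.
    by apply: J0min; [apply: VD | rewrite inE xJ].
  by rewrite disjoint_sym => /disjointFr->.
rewrite big_distrr /=.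
rewrite (reindex_onto (fun J => J0 :|: J) (fun J => J :\: J0)) /=; last first.
  move=> J /andP[/andP[VJ JD] xJ].
  by rewrite -{1}(setIidPr (J0min J VJ xJ)) setID.
apply: eq_big => [J|J /andP[_ /eqP JE]].
  apply/idP/idP => [/andP[/andP[/andP[VJ JD] _] /eqP JE]|].
    by rewrite -JE; apply/andP; split; [apply: VD | apply: setSD].
  rewrite subsetD => /andP[VJ /andP[JD dis]].
  rewrite (VU _ _ VJ0 VJ) subUset J0D JD inE xJ0 /=.
  by rewrite setDUl setDv set0U; apply/eqP/setDidPl.
have dis : [disjoint J & J0].
  by apply/setDidPl; rewrite -{2}JE setDUl setDv set0U.
by rewrite -bigU /= 1?disjoint_sym //; apply: eq_bigl => i; rewrite !inE.
Qed.

(** * Sets permuted by a self-map, and permanents *)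

(** For differences: if [y] in [J :\: K] had [f y] in [K], then [f y] would also be the image of a
    point of [J :&: K], which [f] permutes, and injectivity on [J] would put [y] in [K]. *)
Lemma invariant_set_ring {T : finType} (f : T -> T) :
  set_ring (fun J : {set T} => f @: J == J).
Proof.
have inj (J : {set T}) : f @: J = J -> {in J &, injective f}.
  by move=> fJ; apply/imset_injP; rewrite fJ.
have fin (J : {set T}) y : f @: J = J -> y \in J -> f y \in J.
  by move=> fJ yJ; rewrite -fJ imset_f.
have sub (J K : {set T}) : f @: J = J -> K \subset J ->
    {in K, forall y, f y \in K} -> f @: K == K.
  move=> fJ KJ fK; rewrite eqEcard; apply/andP; split.
    by apply/subsetP=> _ /imsetP[y yK ->]; apply: fK.
  rewrite card_in_imset //; move=> y z /(subsetP KJ) yJ /(subsetP KJ) zJ.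
  exact: (inj J).
split=> [|J K /eqP fJ /eqP fK|J K /eqP fJ /eqP fK]; first by rewrite imset0.
  by rewrite imsetU fJ fK.
apply: (sub J) => //; first exact: subsetDl.
move=> y; rewrite !inE => /andP[yK yJ]; rewrite (fin J) // andbT.
apply: contraNN yK => fyK.
have /eqP fI : f @: (J :&: K) == J :&: K.
  apply: (sub J) => //; first exact: subsetIl.
  by move=> z; rewrite !inE => /andP[zJ zK]; rewrite (fin J) // (fin K).
have : f y \in f @: (J :&: K) by rewrite fI inE fyK (fin J).
by case/imsetP=> z; rewrite inE => /andP[zJ zK] /(inj J fJ _ _ yJ zJ) ->.
Qed.

(** The left side is the permanent of the identity plus the matrix with entries [c i] at [(i, f i)];
    [J] collects the rows where [c i] is chosen in the expansion. *)
Lemma per_functional {R : comNzRingType} {n : nat} (f : 'I_n -> 'I_n)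
    (c : 'I_n -> R) :
  \sum_(s : 'S_n) \prod_i (c i * (s i == f i)%:R + (s i == i)%:R) =
  \sum_(J : {set 'I_n} | f @: J == J) \prod_(i in J) c i.
Proof.
under eq_bigr do rewrite bigA_distr.
rewrite exchange_big [RHS]big_mkcond /=; apply: eq_bigr => J _.
(* Only the permutation equal to [f] on [J] and to the identity elsewhere contributes. *)
pose g i := if i \in J then f i else i.
have termE (s : 'S_n) :
    \prod_i (if i \in J then c i * (s i == f i)%:R else (s i == i)%:R) =
    if [forall i, s i == g i] then \prod_(i in J) c i else 0.
  case: ifPn => [/forallP sg|].
    rewrite [RHS]big_mkcond; apply: eq_bigr => i _; have := sg i.
    by rewrite /g; case: ifP => _ ->; rewrite ?mulr1.
  rewrite negb_forall => /existsP[i sgi]; rewrite (bigD1 i) //=.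
  by move: sgi; rewrite /g; case: ifP => _ /negbTE->; rewrite ?mulr0 mul0r.
under eq_bigr do rewrite termE.
case: ifPn => [/eqP fJ | fJ].
  have injJ : {in J &, injective f} by apply/imset_injP; rewrite fJ.
  have fin y : y \in J -> f y \in J by move=> yJ; rewrite -fJ imset_f.
  have injg : injective g.
    move=> y z; rewrite /g; case: ifPn => yJ; case: ifPn => zJ //.
    - exact: injJ.
    - by move=> E; rewrite -E fin in zJ.
    - by move=> E; rewrite E fin in yJ.
  rewrite -big_mkcond (big_pred1 (perm injg)) // => s /=.
  apply/forallP/eqP => [sg|-> i]; last by rewrite permE.
  by apply/permP=> i; rewrite permE; apply/eqP.
(* If [s] agrees with [g] and some [y] in [J] has [f y] outside [J], then [s] sends both [y] and
   [f y] to [f y]. *)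
rewrite big1 // => s _; case: ifPn => // /forallP sg.
case/negP: fJ; rewrite eqEcard; apply/andP; split.
  apply/subsetP=> _ /imsetP[y yJ ->]; apply/negPn/negP => fyJ.
  have : s y = s (f y).
    by rewrite (eqP (sg y)) (eqP (sg (f y))) /g yJ (negbTE fyJ).
  by move/perm_inj => E; rewrite -E yJ in fyJ.
rewrite card_in_imset // => y z yJ zJ fyz; apply: (@perm_inj _ s).
by rewrite (eqP (sg y)) (eqP (sg z)) /g yJ zJ.
Qed.

(** * The upper bound *)

(* Convexity of [ln (1 + t^2)] on [0, 1]: [(1 + a^2) (1 + b^2) = (a + b)^2 + (1 - a b)^2],
   so at a fixed sum, moving [a] and [b] towards the ends of [0, 1] increases the product. *)
Lemma transfer_bound {R : realFieldType} (m : nat) (u t S Z : R) :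
  0 <= u <= 1 -> 0 <= t <= 1 -> 0 <= S -> S + 2 * t <= 2 * (m%:R + u) ->
  (forall (m' : nat) (u' : R), 0 <= u' <= 1 -> S <= 2 * (m'%:R + u') ->
     Z <= 2 ^+ m' * (1 + u' ^+ 2)) ->
  (1 + t ^+ 2) * Z <= 2 ^+ m * (1 + u ^+ 2).
Proof.
move=> /andP[u0 u1] /andP[t0 t1] S0 St HZ.
have t2 : 0 <= 1 + t ^+ 2 by rewrite addr_ge0 ?sqr_ge0.
(* Write [m + u - t] as [m' + u']: subtract [t] from [u] if possible, otherwise borrow 1 from
   [m]. *)
case: (lerP t u) => tu.
  have /(ler_wpM2l t2)/le_trans -> // : Z <= 2 ^+ m * (1 + (u - t) ^+ 2).
    by apply: HZ; lra.
  rewrite mulrCA ler_wpM2l ?exprn_ge0 //.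
  have h1 : 0 <= t * (u - t) by apply: mulr_ge0; lra.
  have h2 : t * (u - t) <= 1 by nra.
  by nra.
case: m St => [|m] St; first by lra.
have /(ler_wpM2l t2)/le_trans -> // : Z <= 2 ^+ m * (1 + (1 + u - t) ^+ 2).
  by apply: HZ; [lra | move: St; rewrite -natr1; lra].
rewrite mulrCA (exprSr _ m) -mulrA ler_wpM2l ?exprn_ge0 //.
(* With [b = 1 + u - t], [h1] and [h2] say [u <= t b <= 1], so [(1 - t b)^2 <= (1 - u)^2], while
   [t + b = 1 + u]. *)
have h1 : 0 <= (t - u) * (1 - t) by apply: mulr_ge0; lra.
have h2 : t * (1 + u - t) <= 1 by nra.
by nra.
Qed.

(** Strong induction on [#|D|], with [m] and [u] free since removing a minimal member changes the
    sum available to the rest. *)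
Lemma set_ring_sum_bound {R : realFieldType} {T : finType} {V : pred {set T}}
    (r : T -> R) (D : {set T}) (m : nat) (u : R) :
  set_ring V -> (forall i, 0 <= r i <= 1) -> 0 <= u <= 1 ->
  \sum_(i in D) r i <= 2 * (m%:R + u) ->
  \sum_(J : {set T} | V J && (J \subset D)) \prod_(i in J) - r i <=
    2 ^+ m * (1 + u ^+ 2).
Proof.
move=> Vring r01; have [V0 _ _] := Vring.
have [k] := ubnP #|D|; elim: k D m u => // k IHk D m u leDk u01 sumD.
have v1 : 1 <= 2 ^+ m * (1 + u ^+ 2).
  by rewrite mulr_ege1 ?exprn_ege1 ?ler1n ?lerDl ?sqr_ge0.
case: (pickP (fun x => [exists J : {set T}, [&& V J, J \subset D & x \in J]]))
    => [x /existsP[C /and3P[VC CD xC]] | noJ]; last first.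
  rewrite (big_pred1 set0) ?big_set0 // => J /=; apply/idP/eqP=> [|->].
    move=> /andP[VJ JD]; apply/setP=> x; rewrite inE; apply/negP=> xJ.
    by have /existsP[] := noJ x; exists J; rewrite VJ JD.
  by rewrite V0 sub0set.
have [J0 /minsetP[/andP[VJ0 xJ0] J0m] J0C] :
    {J0 | minset (fun J => V J && (x \in J)) J0 & J0 \subset C}.
  by apply: minset_exists; rewrite VC.
have J0D := subset_trans J0C CD.
have J0min J : V J -> x \in J -> J0 \subset J.
  move=> VJ xJ; rewrite -(J0m (J :&: J0)) ?subsetIl ?subsetIr //.
  by rewrite set_ringI // inE xJ.
rewrite (sum_set_ring_split _ Vring VJ0 xJ0 J0D J0min).
set Z := \sum_(J | _) _.
have leD' : (#|D :\: J0| < k)%N.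
  apply: leq_trans (_ : #|D| <= k)%N => //; apply: proper_card.
  rewrite properEneq subsetDl andbT; apply/eqP => E.
  by have := subsetP J0D x xJ0; rewrite -E inE xJ0.
have rge0 i : 0 <= r i by case/andP: (r01 i).
have rle1 i : r i <= 1 by case/andP: (r01 i).
have S0 : 0 <= \sum_(i in D :\: J0) r i by apply: sumr_ge0.
have IH m' u' := IHk (D :\: J0) m' u' leD'.
have DE : \sum_(i in D) r i = \sum_(i in J0) r i + \sum_(i in D :\: J0) r i.
  by rewrite (big_setID J0) /= (setIidPr J0D).
have [J0x|] := eqVneq J0 [set x].
  have p0 : \prod_(i in J0) - r i = - r x by rewrite J0x big_set1.
  have ZB : Z <= 2 ^+ m * (1 + u ^+ 2).
    apply: IH => //; apply: le_trans sumD.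
    by rewrite DE lerDr sumr_ge0.
  rewrite p0; have := rge0 x; have := rle1 x; nra.
rewrite eq_sym eqEsubset sub1set xJ0 /= => /subsetPn[y yJ0]; rewrite inE => yx.
have yJ0x : (y \in J0) && (y != x) by rewrite yJ0.
have p1 : `|\prod_(i in J0) - r i| <= r x * r y.
  rewrite normr_prod (bigD1 x) //= (bigD1 y) //= !normrN !ger0_norm //.
  rewrite ler_wpM2l // ler_piMr // prodr_ile1 // => i.
  by rewrite normrN ger0_norm.
have s1 : r x + r y <= \sum_(i in J0) r i.
  by rewrite (bigD1 x) //= (bigD1 y) //= lerD2l lerDl sumr_ge0.
have p2 : 0 <= 1 + \prod_(i in J0) - r i.
  have := rge0 x; have := rge0 y; have := rle1 x; have := rle1 y.
  by move: p1; rewrite ler_norml => /andP[p1 _] *; nra.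
have p3 : 1 + \prod_(i in J0) - r i <= 1 + ((r x + r y) / 2) ^+ 2.
  have := le_trans (ler_norm _) p1; have := sqr_ge0 (r x - r y); nra.
(* A negative [Z] makes the product at most 0; otherwise the factor is replaced by its bound, with
   [t] the mean of [r x] and [r y]. *)
case: (lerP 0 Z) => Z0; last first.
  apply: le_trans (le_trans ler01 v1).
  by rewrite mulr_ge0_le0 // ltW.
apply: (le_trans (ler_wpM2r Z0 p3)).
apply: (@transfer_bound _ m u _ (\sum_(i in D :\: J0) r i)) => //.
- have := rge0 x; have := rge0 y; have := rle1 x; have := rle1 y; lra.
- by move: sumD; rewrite DE; lra.
Qed.

Lemma per_subId_bound {R : realFieldType} {n : nat} (A : 'M[R]_n) (m : nat) (u : R) :
  (forall i j, 0 <= A i j) -> (forall i, \sum_j A i j <= 1) ->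
  0 <= u <= 1 -> sigma A <= 2 * (m%:R + u) ->
  per (1%:M - A) <= 2 ^+ m * (1 + u ^+ 2).
Proof.
move=> A0 A1 u01 sA.
pose r i := \sum_j A i j.
(* Row [i] is [r i] times the probability vector [p i]; a zero row gets the point mass at [i]. *)
pose p i j := if r i == 0 then (j == i)%:R else A i j / r i.
have r0 i : 0 <= r i by apply: sumr_ge0.
have p0 i j : 0 <= p i j by rewrite /p; case: ifP => _; rewrite ?ler0n ?divr_ge0.
have p1 i : \sum_j p i j = 1.
  rewrite /p; case: (r i =P 0) => [_|/eqP ri]; last by rewrite -mulr_suml divff.
  by rewrite (bigD1 i) //= eqxx big1 ?addr0 // => j /negbTE->.
have rp i j : r i * p i j = A i j.
  rewrite /p; case: ifPn => [/eqP ri|ri]; last by rewrite mulrC divfK.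
  by rewrite ri mul0r; rewrite (psumr_eq0P _ ri).
(* By multilinearity in the rows, the permanent is the mean over [f] with independent values [f i]
   distributed as [p i]. *)
have perE : per (1%:M - A) = \sum_(f : {ffun 'I_n -> 'I_n})
    (\prod_i p i (f i)) * \sum_(J : {set 'I_n} | f @: J == J) \prod_(i in J) - r i.
  under [RHS]eq_bigr => f _ do rewrite -per_functional big_distrr /=.
  rewrite exchange_big /=; apply: eq_bigr => s _.
  under [RHS]eq_bigr => f _ do rewrite -big_split /=.
  rewrite -(bigA_distr_bigA
    (fun i j => p i j * (- r i * (s i == j)%:R + (s i == i)%:R))) /=.
  apply: eq_bigr => i _; rewrite !mxE.
  under eq_bigr do rewrite mulrDr.
  rewrite big_split /= -mulr_suml p1 mul1r addrC eq_sym; congr (_ + _).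
  rewrite (bigD1 (s i)) //= eqxx big1 ?addr0; last first.
    by move=> j /negbTE js; rewrite eq_sym js !mulr0.
  by rewrite mulr1 mulrN mulrC rp.
have -> : 2 ^+ m * (1 + u ^+ 2) = \sum_(f : {ffun 'I_n -> 'I_n})
    (\prod_i p i (f i)) * (2 ^+ m * (1 + u ^+ 2)).
  rewrite -mulr_suml -bigA_distr_bigA big1 ?mul1r // => i _; exact: p1.
rewrite perE; apply: ler_sum => f _; rewrite ler_wpM2l ?prodr_ge0 //.
under eq_bigl => J do rewrite -[_ == _]andbT -(subsetT J).
apply: set_ring_sum_bound => // [|i|]; first exact: invariant_set_ring.
  by rewrite r0 A1.
by under eq_bigl do rewrite inE.
Qed.

(** * Extremal matrices built from 2 x 2 blocks *)

(** Exchanges [2k] and [2k+1]; the default of [insubd] fixes the last index when [n] is odd. *)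
Definition swap_pair {n : nat} (i : 'I_n) : 'I_n :=
  insubd i (if odd i then i.-1 else i.+1).

Lemma val_swap_pair {n : nat} (i : 'I_n) :
  swap_pair i = (if odd i then i.-1 else if i.+1 < n then i.+1 else i)%N :> nat.
Proof.
by rewrite val_insubd /=; case: (odd i); rewrite // (leq_ltn_trans (leq_pred i)).
Qed.

Lemma swap_pairK {n : nat} : involutive (@swap_pair n).
Proof.
move=> i; apply: val_inj; rewrite /= !val_swap_pair; have := ltn_ord i.
by repeat case: ifP; lia.
Qed.

Lemma swap_pair_half {n : nat} (i : 'I_n) : (swap_pair i)./2 = i./2.
Proof. by rewrite val_swap_pair; repeat case: ifP; lia. Qed.

(** Induction on the number of blocks: the last block [{2K, 2K+1}] is a minimal permuted set, with
    factor [1 + (- c K) * (- c K)]. *)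
Lemma per_swap_blocks {R : comNzRingType} {n : nat} (c : nat -> R) (K : nat) :
  (K <= n./2)%N ->
  \sum_(i in [set i : 'I_n | i./2 < K]%N) c i./2 = \sum_(k < K) c k *+ 2 /\
  \sum_(J : {set 'I_n} | (swap_pair @: J == J) && (J \subset [set i : 'I_n | i./2 < K]%N))
     \prod_(i in J) - c i./2 = \prod_(k < K) (1 + c k ^+ 2).
Proof.
elim: K => [_|K IHK Kn].
  have -> : [set i : 'I_n | i./2 < 0]%N = set0 by apply/setP => i; rewrite !inE.
  rewrite !big_ord0 big_set0; split=> //; rewrite (big_pred1 set0) ?big_set0 // => J /=.
  rewrite subset0; apply/andP/eqP => [[_ /eqP //]|->].
  by rewrite imset0 !eqxx.
have [IHs IHp] := IHK (ltnW Kn).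
have x_lt : (K.*2 < n)%N by lia.
pose x := Ordinal x_lt; pose J0 := [set x; swap_pair x].
have vy : swap_pair x = K.*2.+1 :> nat.
  by rewrite val_swap_pair /= odd_double; case: ifP => //; lia.
have xy : x != swap_pair x by rewrite -val_eqE /= vy; lia.
have J0E (i : 'I_n) : (i \in J0) = (i./2 == K).
  by rewrite !inE -!val_eqE /= vy; lia.
have J0D : J0 \subset [set i : 'I_n | i./2 < K.+1]%N.
  by apply/subsetP=> i; rewrite J0E inE => /eqP->.
have DE : [set i : 'I_n | i./2 < K.+1]%N :\: J0 = [set i : 'I_n | i./2 < K]%N.
  by apply/setP=> i; rewrite in_setD J0E !inE; lia.
have VJ0 : swap_pair @: J0 == J0.
  by rewrite imsetU1 imset_set1 swap_pairK setUC.
split.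
  by rewrite (big_setID J0) /= (setIidPr J0D) DE IHs big_setU1 ?inE //= big_set1
    swap_pair_half /= doubleK big_ord_recr /= addrC mulr2n.
rewrite (sum_set_ring_split _ (invariant_set_ring _) VJ0 (set21 _ _) J0D); last first.
  move=> J /eqP fJ xJ; apply/subsetP=> i; rewrite !inE => /orP[] /eqP-> //.
  by rewrite -fJ imset_f.
rewrite DE IHp big_setU1 ?inE //= big_set1 swap_pair_half /= doubleK.
by rewrite big_ord_recr /= mulrNN mulrC expr2.
Qed.

(** Since [c] vanishes from [K] on, sets meeting an index outside the first [K] blocks contribute 0;
    this covers the unpaired index for odd [n]. *)
Lemma per_subId_swap {R : comNzRingType} {n : nat} (c : nat -> R) (K : nat) :
  (K <= n./2)%N -> (forall k, (K <= k)%N -> c k = 0) ->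
  let A := \matrix_(i < n, j < n) (c i./2 * (j == swap_pair i)%:R) in
  (\sum_i \sum_j A i j = \sum_(k < K) c k *+ 2) /\
  per (1%:M - A) = \prod_(k < K) (1 + c k ^+ 2).
Proof.
move=> Kn c0 A; have [<- <-] := per_swap_blocks c K Kn; split.
  rewrite [RHS]big_mkcond /=; apply: eq_bigr => i _.
  rewrite (bigD1 (swap_pair i)) //= mxE eqxx mulr1 big1 ?addr0 => [|j /negbTE ji].
    by rewrite inE; case: ltnP => // /c0.
  by rewrite mxE ji mulr0.
transitivity (\sum_(J : {set 'I_n} | swap_pair @: J == J) \prod_(i in J) - c i./2).
  rewrite -per_functional; apply: eq_bigr => s _; apply: eq_bigr => i _.
  by rewrite !mxE addrC mulNr [i == s i]eq_sym.
rewrite big_mkcondr /=; apply: eq_bigr => J _; case: ifPn => // /subsetPn[i iJ].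
by rewrite inE -leqNgt => /c0 ci; rewrite (bigD1 i) //= ci oppr0 mul0r.
Qed.

Theorem mainTheorem13 (R : rcfType) (n : nat) (s : R) (e : nat) :
  (1 <= n)%N -> 0 <= s ->
  ((~~ odd n /\ s <= n%:R) \/ (odd n /\ s <= (n.-1)%:R)) ->
  (* e is the greatest even integer with e <= s *)
  ~~ odd e -> e%:R <= s -> s < (e.+2)%:R ->
  let v := 2 ^+ (e./2) * (1 + ((s - e%:R) / 2) ^+ 2) in
  (exists A : 'M[R]_n, omega s A /\ per (1%:M - A) = v) /\
  (forall A : 'M[R]_n, omega s A -> per (1%:M - A) <= v).
Proof.
move=> n1 s0 sn ev es se v.
have eE : e = e./2.*2 by lia.
have eR : e%:R = 2 * (e./2)%:R :> R by rewrite {1}eE -muln2 natrM mulrC.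
set t := (s - e%:R) / 2 in v *.
have t01 : 0 <= t <= 1 by move: se; rewrite /t -addn2 natrD; lra.
have sE : s = 2 * ((e./2)%:R + t) by rewrite /t; lra.
split; last first.
  by move=> A [[A0 [A1 _]] sA]; apply: per_subId_bound => //; rewrite sA sE.
have sm : s <= 2 * (n./2)%:R.
  suff <- : (n./2.*2)%:R = 2 * (n./2)%:R :> R.
    by case: sn => -[on] /le_trans; apply; rewrite ler_nat; lia.
  by rewrite -muln2 natrM mulrC.
have em : (e./2 <= n./2)%N by rewrite -(ler_nat R); lra.
(* Either a block is left to carry the weight [t], or the full blocks exhaust [s] and [t] is 0. *)
have tm : (e./2 < n./2)%N \/ t = 0.
  move: em; rewrite leq_eqVlt => /orP[/eqP E|]; last by left.
  by right; move: t01 sm; rewrite sE E; lra.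
(* There are [e./2] blocks of weight 1 and one of weight [t], for a total of [e + 2 t = s]. *)
pose c k : R := if (k < e./2)%N then 1 else if k == e./2 then t else 0.
pose K := if (e./2 < n./2)%N then e./2.+1 else e./2.
have c01 k : 0 <= c k <= 1 by rewrite /c; do 2?case: ifP => _ //; rewrite ?ler01 ?lexx.
have Kn : (K <= n./2)%N by rewrite /K; case: ifP.
have cK k : (K <= k)%N -> c k = 0.
  rewrite /K /c; case: ifP => h; first by do 2?case: ifP => //; lia.
  case: tm => [|->]; first by rewrite h.
  by move=> ek; rewrite ltnNge ek /=; case: ifP.
have ce : c e./2 = t by rewrite /c ltnn eqxx.
have c1 (k : 'I_e./2) : c k = 1 by rewrite /c ltn_ord.
have [sA perA] := per_subId_swap (n := n) c K Kn cK.
exists (\matrix_(i < n, j < n) (c i./2 * (j == swap_pair i)%:R)).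
(* As [swap_pair] is an involution, column sums are computed like row sums. *)
have delta (i j : 'I_n) : (j == swap_pair i) = (i == swap_pair j).
  by rewrite -(inj_eq (inv_inj swap_pairK)) swap_pairK eq_sym.
split; last first.
  rewrite perA /K /v; case: ifP => h.
    rewrite big_ord_recr /= ce; congr (_ * _).
    by under eq_bigr do rewrite c1 expr1n; rewrite prodr_const card_ord.
  case: tm => [|t0]; first by rewrite h.
  rewrite t0 expr0n /= addr0 mulr1.
  by under eq_bigr do rewrite c1 expr1n; rewrite prodr_const card_ord.
split; last first.
  rewrite /sigma sA /K sE; case: ifP => h.
    rewrite big_ord_recr /= ce; under eq_bigr do rewrite c1.
    by rewrite sumr_const card_ord -mulrnA; rewrite mulnC mulrnA -[1 *+ _]/(_%:R); ring.
  case: tm => [|->]; first by rewrite h.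
  under eq_bigr do rewrite c1.
  by rewrite sumr_const card_ord -mulrnA mulnC mulrnA; ring.
have c0 k : 0 <= c k by case/andP: (c01 k).
have c_le1 k : c k <= 1 by case/andP: (c01 k).
split; [|split].
- by move=> i j; rewrite mxE mulr_ge0 ?ler0n.
- move=> i; rewrite (bigD1 (swap_pair i)) //= mxE eqxx mulr1.
  by rewrite big1 ?addr0 // => j /negbTE ji; rewrite mxE ji mulr0.
- move=> j; rewrite (bigD1 (swap_pair j)) //= mxE delta eqxx mulr1.
  by rewrite big1 ?addr0 // => i /negbTE ij; rewrite mxE delta ij mulr0.
Qed.
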